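(* Let $\theta\in(0,1)$. The Dirichlet-Neumann algorithm DN$_3$ converges if and only if $$\rho_{\mathrm{DN}_3}:=\max_{1\le i\le n}\Big|1-\theta\Big(1+\frac{\sigma_i+d_i\coth(a_i)}{\sigma_i\coth(a_i)+d_i}\cdot\frac{\gamma\sigma_i\coth(b_i)+\beta_i}{\gamma\sigma_i+\beta_i\coth(b_i)}\Big)\Big|<1.$$
   Context: Let $A\in\mathbb{R}^{n\times n}$ be symmetric with eigenvalues $d_1,\dots,d_n$, and let $\nu>0$, $\gamma\ge 0$, $T>0$, $0<\alpha<T$. Set $\Omega_1=(0,\alpha)$, $\Omega_2=(\alpha,T)$, $\sigma_i=\sqrt{d_i^2+\nu^{-1}}$, $\beta_i=1-\gamma d_i$, $a_i=\sigma_i\alpha$, $b_i=\sigma_i(T-\alpha)$. Algorithm DN$_3$ (error equations): for each $i$, given an initial guess $f_i^0\in\mathbb{R}$, for $k=1,2,\dots$: (1) solve $\dot z_{1,i}^k+d_iz_{1,i}^k-\nu^{-1}\mu_{1,i}^k=0$, $\dot\mu_{1,i}^k-z_{1,i}^k-d_i\mu_{1,i}^k=0$ in $\Omega_1$ with $z_{1,i}^k(0)=0$, $\mu_{1,i}^k(\alpha)=f_i^{k-1}$; (2) solve $\dot z_{2,i}^k+d_iz_{2,i}^k-\nu^{-1}\mu_{2,i}^k=0$, $\dot\mu_{2,i}^k-z_{2,i}^k-d_i\mu_{2,i}^k=0$ in $\Omega_2$ with $\dot\mu_{2,i}^k(\alpha)=\dot\mu_{1,i}^k(\alpha)$, $\mu_{2,i}^k(T)+\gamma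 z_{2,i}^k(T)=0$; (3) set $f_i^k=(1-\theta)f_i^{k-1}+\theta\mu_{2,i}^k(\alpha)$. Assume all subdomain problems are uniquely solvable for every datum, so that the algorithm is well defined. The algorithm converges if $f_i^k\to 0$ as $k\to\infty$ for every $i$ and every initial guess $(f_1^0,\dots,f_n^0)\in\mathbb{R}^n$. *)

(* Defs.v *)
From HB Require Import structures.
From mathcomp Require Export all_boot all_order all_algebra.
From mathcomp Require Export all_classical all_reals all_analysis.
Set Implicit Arguments.
Unset Strict Implicit.
Unset Printing Implicit Defensive.
Export Order.TTheory GRing.Theory Num.Theory.
Export numFieldNormedType.Exports.
Local Open Scope classical_set_scope.
Local Open Scope ring_scope.

Definition sinh (R : realType) (x : R) : R := (expR x - expR (- x)) / 2.
Definition cosh (R : realType) (x : R) : R := (expR x + expR (- x)) / 2.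
Definition coth (R : realType) (x : R) : R := cosh x / sinh x.

(* One-sided derivatives: a subdomain solution is only meaningful on one side
   of the interface, so [derive1] must not be used there. *)
Definition is_left_derivative (R : realType) (f : R -> R) (x l : R) : Prop :=
  (f (x + h) - f x) / h @[h --> 0^'-] --> l.
Definition is_right_derivative (R : realType) (f : R -> R) (x l : R) : Prop :=
  (f (x + h) - f x) / h @[h --> 0^'+] --> l.

(* The values at [a] and [b] are the boundary traces: [z] and [mu] are
   differentiable on the open interval and one-sidedly continuous at both
   ends. Values outside [a, b] are irrelevant. *)
Definition optimality_system (R : realType) (nu d a b : R) (z mu : R -> R) :
    Prop :=
  [/\ derivable_oo_LRcontinuous z a b,
      derivable_oo_LRcontinuous mu a b,
      {in `]a, b[, forall t, derive1 z t + d * z t - nu^-1 * mu t = 0} &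
      {in `]a, b[, forall t, derive1 mu t - z t - d * mu t = 0}].

Definition dirichlet_problem (R : realType) (nu alpha d f : R)
    (z mu : R -> R) : Prop :=
  [/\ optimality_system nu d 0 alpha z mu, z 0 = 0 & mu alpha = f].

Definition neumann_problem (R : realType) (nu gamma T alpha d g : R)
    (z mu : R -> R) : Prop :=
  [/\ optimality_system nu d alpha T z mu,
      is_right_derivative mu alpha g & mu T + gamma * z T = 0].

(* Functions are identified when they agree on [a, b]. *)
Definition uniquely_solvable (R : realType) (a b : R)
    (problem : (R -> R) -> (R -> R) -> Prop) : Prop :=
  exists z mu, problem z mu /\
    forall z' mu', problem z' mu' ->
      {in `[a, b], z' =1 z} /\ {in `[a, b], mu' =1 mu}.

Definition subproblems_well_posed (R : realType) (nu gamma T alpha d : R) :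
    Prop :=
  (forall f, uniquely_solvable 0 alpha (dirichlet_problem nu alpha d f)) /\
  (forall g,
     uniquely_solvable alpha T (neumann_problem nu gamma T alpha d g)).

Definition DN3_step (R : realType) (nu gamma T alpha theta d : R)
    (f f' : R) : Prop :=
  exists z1 mu1 z2 mu2 g,
    [/\ dirichlet_problem nu alpha d f z1 mu1,
        is_left_derivative mu1 alpha g,
        neumann_problem nu gamma T alpha d g z2 mu2 &
        f' = (1 - theta) * f + theta * mu2 alpha].

(* [f k i] is the k-th iterate in the i-th eigencomponent. Under
   [subproblems_well_posed] such a sequence exists and is unique for each
   initial guess [f0]. *)
Definition DN3_iterates (R : realType) (n : nat) (nu gamma T alpha theta : R)
    (d f0 : 'I_n -> R) (f : nat -> 'I_n -> R) : Prop :=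
  f 0%N = f0 /\
  forall (k : nat) (i : 'I_n),
    DN3_step nu gamma T alpha theta (d i) (f k i) (f k.+1 i).

Definition DN3_converges (R : realType) (n : nat)
    (nu gamma T alpha theta : R) (d : 'I_n -> R) : Prop :=
  forall (f0 : 'I_n -> R) (f : nat -> 'I_n -> R),
    DN3_iterates nu gamma T alpha theta d f0 f ->
    forall i : 'I_n, f k i @[k --> \oo] --> (0 : R).

Definition DN3_factor (R : realType) (nu gamma T alpha theta d : R) : R :=
  let sigma := Num.sqrt (d ^+ 2 + nu^-1) in
  let beta := 1 - gamma * d in
  let a := sigma * alpha in
  let b := sigma * (T - alpha) in
  1 - theta * (1 + (sigma + d * coth a) / (sigma * coth a + d) *
                   ((gamma * sigma * coth b + beta) /
                    (gamma * sigma + beta * coth b))).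

(* The terms are nonnegative, so for n > 0 the default value 0 does not
   affect the maximum. *)
Definition rho_DN3 (R : realType) (n : nat) (nu gamma T alpha theta : R)
    (d : 'I_n -> R) : R :=
  \big[Num.max/0]_(i < n) `|DN3_factor nu gamma T alpha theta (d i)|.

(* Main.v *)
(* The error equations have constant coefficient matrix [[-d, 1/nu], [1, d]],
   whose square is sigma^2 times the identity, so cosh and sinh give explicit
   solutions of both subdomain problems. Unique solvability says that these are
   the only solutions, and also that the denominators in the convergence factor
   do not vanish: otherwise a homogeneous problem would have a nonzero solution.
   Hence each step multiplies the i-th component by DN3_factor, and the iterates
   form a geometric sequence. *)
Require Import Defs.
From mathcomp Require Import ring lra.
Set Implicit Arguments.
Unset Strict Implicit.
Unset Printing Implicit Defensive.
Local Open Scope classical_set_scope.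
Local Open Scope ring_scope.

Lemma sinh_gt0 (R : realType) (x : R) : 0 < x -> 0 < sinh x.
Proof. by move=> x0; rewrite divr_gt0// subr_gt0 ltr_expR; lra. Qed.

Lemma sinh0 (R : realType) : sinh (0 : R) = 0.
Proof. by rewrite /sinh oppr0 subrr mul0r. Qed.

Lemma cosh0 (R : realType) : cosh (0 : R) = 1.
Proof. by rewrite /cosh oppr0 expR0; field. Qed.

Lemma is_derive_cosh_sinh (R : realType) (s t0 p q t : R) :
  is_derive t 1 (fun u : R => p * cosh (s * (u - t0)) + q * sinh (s * (u - t0)))
    (s * (p * sinh (s * (t - t0)) + q * cosh (s * (t - t0)))).
Proof.
have de (c : R) : is_derive t 1 (fun u : R => expR (c * (u - t0)))
    (expR (c * (t - t0)) * c).
  pose g := fun u : R => c * (u - t0).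
  have dg : is_derive t 1 g c.
    by apply: is_derive_eq; rewrite /GRing.scale/=; ring.
  exact: (@is_derive1_comp _ expR g).
have de1 := de s; have := de (- s).
under eq_fun do rewrite mulNr.
rewrite mulNr => de2; rewrite /cosh /sinh.
by apply: is_derive_eq; rewrite /GRing.scale/=; field.
Qed.

Lemma is_derive_cvg_slope (R : realType) (f : R -> R) (x l : R) :
  is_derive x 1 f l -> (f (x + h) - f x) / h @[h --> 0^'] --> l.
Proof.
move=> [df <-].
suff -> : (fun h : R => (f (x + h) - f x) / h) =
  (fun h : R => h^-1 *: (f (h *: 1 + x) - f x)) by exact: df.
by apply/funext => h; rewrite /GRing.scale/= mulr1 mulrC (addrC x).
Qed.

(** Uniqueness identifies subdomain solutions only on the closed subdomain. This suffices to fix the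
    flux passed through the interface, since a left derivative sees only values at and to the left
    of [x]. *)
Lemma left_derivative_unique (R : realType) (f g : R -> R) (a x l l' : R) :
  a < x -> {in `[a, x], f =1 g} ->
  is_left_derivative f x l -> is_left_derivative g x l' -> l = l'.
Proof.
move=> ax fg fl gl; apply: (cvg_unique _ fl); first exact: norm_hausdorff.
apply: cvg_trans gl; apply: near_eq_cvg.
near=> h.
have h0 : h <= 0 by near: h; exact: nbhs_left_le.
have ah : a - x < h by near: h; apply: nbhs_left_gt; rewrite subr_lt0.
by rewrite !fg// in_itv/=; apply/andP; split; lra.
Unshelve. all: by end_near. Qed.

Lemma is_derive_LRcontinuous (R : realType) (f df : R -> R) (a b : R) :
  (forall t : R, is_derive t 1 f (df t)) -> derivable_oo_LRcontinuous f a b.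
Proof.
move=> fdf.
have cf : continuous f.
  move=> t; apply: differentiable_continuous; apply/derivable1_diffP.
  exact: ex_derive.
split => [t _| |]; first exact: ex_derive.
- exact/cvg_at_right_filter/cf.
- exact/cvg_at_left_filter/cf.
Qed.

Section flow.
Context {R : realType}.
Variables (nu d : R).
Hypothesis nu0 : 0 < nu.

Let sigma : R := Num.sqrt (d ^+ 2 + nu^-1).

Lemma sigma_gt0 : 0 < sigma.
Proof. by rewrite sqrtr_gt0 ltr_wpDl ?sqr_ge0 ?invr_gt0. Qed.

(** Makes the later identities rational in [sigma] and [d], so that [field] need not know that
    [sigma] is a square root. *)
Let nuVE : nu^-1 = sigma ^+ 2 - d ^+ 2.
Proof.
by rewrite sqr_sqrtr ?addr_ge0 ?sqr_ge0 ?invr_ge0 ?ltW// addrAC subrr add0r.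
Qed.

(** With [flow_mu], this is the matrix exponential applied to the state [(z0, m0)] at time [t0]: for
    M^2 = sigma^2 I, exp(sM) = cosh(sigma s) I + (sinh(sigma s) / sigma) M. *)
Definition flow_z (t0 z0 m0 t : R) : R :=
  z0 * cosh (sigma * (t - t0)) +
  (nu^-1 * m0 - d * z0) / sigma * sinh (sigma * (t - t0)).

Definition flow_mu (t0 z0 m0 t : R) : R :=
  m0 * cosh (sigma * (t - t0)) +
  (z0 + d * m0) / sigma * sinh (sigma * (t - t0)).

Lemma flow_z0 t0 z0 m0 : flow_z t0 z0 m0 t0 = z0.
Proof. by rewrite /flow_z subrr mulr0 cosh0 sinh0 mulr1 mulr0 addr0. Qed.

Lemma flow_mu0 t0 z0 m0 : flow_mu t0 z0 m0 t0 = m0.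
Proof. by rewrite /flow_mu subrr mulr0 cosh0 sinh0 mulr1 mulr0 addr0. Qed.

Lemma is_derive_flow_z (t0 z0 m0 t : R) : is_derive t 1 (flow_z t0 z0 m0)
  (nu^-1 * flow_mu t0 z0 m0 t - d * flow_z t0 z0 m0 t).
Proof.
apply: (is_derive_eq (is_derive_cosh_sinh sigma t0 z0 ((nu^-1 * m0 - d * z0) / sigma) t)).
rewrite /flow_z /flow_mu nuVE; field; exact: lt0r_neq0 sigma_gt0.
Qed.

Lemma is_derive_flow_mu (t0 z0 m0 t : R) : is_derive t 1 (flow_mu t0 z0 m0)
  (flow_z t0 z0 m0 t + d * flow_mu t0 z0 m0 t).
Proof.
apply: (is_derive_eq (is_derive_cosh_sinh sigma t0 m0 ((z0 + d * m0) / sigma) t)).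
rewrite /flow_z /flow_mu nuVE; field; exact: lt0r_neq0 sigma_gt0.
Qed.

Lemma flow_optimality_system t0 z0 m0 a b :
  optimality_system nu d a b (flow_z t0 z0 m0) (flow_mu t0 z0 m0).
Proof.
split.
- exact: is_derive_LRcontinuous (is_derive_flow_z _ _ _).
- exact: is_derive_LRcontinuous (is_derive_flow_mu _ _ _).
- move=> t _; rewrite derive1E (derive_val (is_derive := is_derive_flow_z _ _ _ _)).
  by ring.
- move=> t _; rewrite derive1E (derive_val (is_derive := is_derive_flow_mu _ _ _ _)).
  by ring.
Qed.

Lemma flow_dirichlet alpha c : dirichlet_problem nu alpha d
  (flow_mu 0 0 c alpha) (flow_z 0 0 c) (flow_mu 0 0 c).
Proof. by split; [exact: flow_optimality_system|exact: flow_z0|]. Qed.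

(** The second equation, read at [alpha], gives the flux [z0 + d * m0]. *)
Lemma flow_neumann gamma T alpha z0 m0 :
  flow_mu alpha z0 m0 T + gamma * flow_z alpha z0 m0 T = 0 ->
  neumann_problem nu gamma T alpha d (z0 + d * m0)
    (flow_z alpha z0 m0) (flow_mu alpha z0 m0).
Proof.
move=> bc; split=> //; first exact: flow_optimality_system.
apply/cvg_dnbhs_at_right/is_derive_cvg_slope.
by apply: (is_derive_eq (is_derive_flow_mu alpha z0 m0 alpha)); rewrite flow_z0 flow_mu0.
Qed.

(** Otherwise the flow from [(0, 1)] and the zero flow would both solve the Dirichlet problem with
    datum 0, yet they differ at time 0. *)
Lemma flow_mu_neq0 alpha : 0 <= alpha ->
  (forall f, uniquely_solvable 0 alpha (dirichlet_problem nu alpha d f)) ->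
  flow_mu 0 0 1 alpha != 0.
Proof.
move=> alpha0 /(_ 0) [z [mu [_ uniq]]]; apply/eqP => f0.
have := flow_dirichlet alpha 1; rewrite f0 => /uniq[_ mu1].
have := flow_dirichlet alpha 0.
have -> : flow_mu 0 0 0 alpha = 0 by rewrite /flow_mu; ring.
move=> /uniq[_ mu2].
have i0 : 0 \in `[0, alpha] by rewrite in_itv/= lexx.
have := mu1 _ i0; rewrite -(mu2 _ i0) !flow_mu0 => /eqP.
by rewrite oner_eq0.
Qed.

(** The state [(- d, 1)] has zero flux. If its Robin value at [T] vanished, its flow and the zero
    flow would both solve the Neumann problem with datum 0, yet they differ at [alpha]. *)
Lemma flow_robin_neq0 gamma T alpha : alpha <= T ->
  (forall g, uniquely_solvable alpha T (neumann_problem nu gamma T alpha d g)) ->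
  flow_mu alpha (- d) 1 T + gamma * flow_z alpha (- d) 1 T != 0.
Proof.
move=> aT /(_ 0) [z [mu [_ uniq]]]; apply/eqP => f0.
have := flow_neumann f0; rewrite mulr1 addNr => /uniq[_ mu1].
have f00 : flow_mu alpha 0 0 T + gamma * flow_z alpha 0 0 T = 0.
  by rewrite /flow_mu /flow_z; ring.
have := flow_neumann f00; rewrite mulr0 addr0 => /uniq[_ mu2].
have i0 : alpha \in `[alpha, T] by rewrite in_itv/= lexx.
have := mu1 _ i0; rewrite -(mu2 _ i0) !flow_mu0 => /eqP.
by rewrite oner_eq0.
Qed.

(** Uniqueness gives the forward direction; the explicit flows give the converse, which supplies
    actual iterates to test convergence on. *)
Lemma DN3_stepE gamma T alpha theta f f' :
  0 < alpha -> alpha < T -> subproblems_well_posed nu gamma T alpha d ->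
  DN3_step nu gamma T alpha theta d f f' <->
  f' = DN3_factor nu gamma T alpha theta d * f.
Proof.
move=> alpha0 aT [wpD wpN].
have muD0 := flow_mu_neq0 (ltW alpha0) wpD.
have robin0 := flow_robin_neq0 (ltW aT) wpN.
(* By linearity, [c] is the value of mu at 0 for which the first subdomain solution reaches [f] at
   [alpha]. *)
pose c := f / flow_mu 0 0 1 alpha.
pose g := flow_z 0 0 c alpha + d * flow_mu 0 0 c alpha.
(* States at [alpha] with flux [g] are [g * (1, 0) + m * (- d, 1)]; the Robin condition at [T] is
   then linear in [m], the new trace of mu. *)
pose m := - g * (flow_mu alpha 1 0 T + gamma * flow_z alpha 1 0 T) /
  (flow_mu alpha (- d) 1 T + gamma * flow_z alpha (- d) 1 T).
have s0 := lt0r_neq0 sigma_gt0.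
have fE : flow_mu 0 0 c alpha = f.
  rewrite -[RHS](divfK muD0) -/c /flow_mu; ring.
have solD := flow_dirichlet alpha c; rewrite fE in solD.
have solN : neumann_problem nu gamma T alpha d g
    (flow_z alpha (g - d * m) m) (flow_mu alpha (g - d * m) m).
  rewrite -[X in neumann_problem _ _ _ _ _ X](subrK (d * m)).
  apply: flow_neumann.
  have : g * (flow_mu alpha 1 0 T + gamma * flow_z alpha 1 0 T) + m *
      (flow_mu alpha (- d) 1 T + gamma * flow_z alpha (- d) 1 T) = 0.
    by rewrite /m divfK// mulNr subrr.
  by move=> <-; rewrite /flow_mu /flow_z; ring.
have gD : is_left_derivative (flow_mu 0 0 c) alpha g.
  exact/cvg_dnbhs_at_left/is_derive_cvg_slope/is_derive_flow_mu.
have factorE : DN3_factor nu gamma T alpha theta d * f =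
    (1 - theta) * f + theta * m.
  have sa : 0 < sinh (sigma * alpha) by rewrite sinh_gt0// mulr_gt0// sigma_gt0.
  have sb : 0 < sinh (sigma * (T - alpha)).
    by rewrite sinh_gt0// mulr_gt0 ?subr_gt0// sigma_gt0.
  have muDE : flow_mu 0 0 1 alpha =
      (sigma * cosh (sigma * alpha) + d * sinh (sigma * alpha)) / sigma.
    by rewrite /flow_mu subr0; field.
  have robinE : flow_mu alpha (- d) 1 T + gamma * flow_z alpha (- d) 1 T =
      gamma * sigma * sinh (sigma * (T - alpha)) +
      (1 - gamma * d) * cosh (sigma * (T - alpha)).
    by rewrite /flow_mu /flow_z nuVE; field.
  (* [k1] and [k2] concern the two denominators of [DN3_factor], multiplied by the positive sinh
     values [sa] and [sb]. *)
  have k1 : sigma * cosh (sigma * alpha) + d * sinh (sigma * alpha) != 0.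
    by apply: contraNneq muD0; rewrite muDE => ->; rewrite mul0r.
  have k2 := robin0; rewrite robinE in k2.
  rewrite /m /g /c robinE muDE /DN3_factor /flow_mu /flow_z -/sigma nuVE.
  rewrite /coth !subr0; field.
  by rewrite k2 s0 k1 !lt0r_neq0.
split.
- move=> [z1 [mu1 [z2 [mu2 [g' [D1 L1 N2 ->]]]]]].
  have [? [? [_ uniqD]]] := wpD f.
  have mu1E : {in `[0, alpha], mu1 =1 flow_mu 0 0 c}.
    by move=> t t0; rewrite (uniqD _ _ D1).2// (uniqD _ _ solD).2.
  have g'E := left_derivative_unique alpha0 mu1E L1 gD; rewrite {}g'E in N2.
  have [? [? [_ uniqN]]] := wpN g.
  have i0 : alpha \in `[alpha, T] by rewrite in_itv/= lexx ltW.
  by rewrite factorE (uniqN _ _ N2).2// -(uniqN _ _ solN).2// flow_mu0.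
- move=> ->; exists (flow_z 0 0 c), (flow_mu 0 0 c).
  exists (flow_z alpha (g - d * m) m), (flow_mu alpha (g - d * m) m), g.
  by split=> //; rewrite flow_mu0.
Qed.

End flow.

(** Some power has modulus below 1, whereas a base of modulus at least 1 has no such power. *)
Lemma cvg_geometric_lt1 (R : realType) (x : R) :
  x ^+ k @[k --> \oo] --> (0 : R) -> `|x| < 1.
Proof.
move=> /cvgr0_norm_lt/(_ _ ltr01) [N _ /(_ N (leqnn N))] /=.
rewrite normrX; apply: contraTT; rewrite -!leNgt; exact: exprn_ege1.
Qed.

Theorem theorem9 (R : realType) (n : nat) (A : 'M[R]_n) (d : 'I_n -> R)
    (nu gamma T alpha theta : R)
    (hn : (0 < n)%N)
    (hA : A^T = A)
    (hd : char_poly A = \prod_(i < n) ('X - (d i)%:P))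
    (hnu : 0 < nu) (hgamma : 0 <= gamma) (hT : 0 < T)
    (halpha0 : 0 < alpha) (halphaT : alpha < T)
    (hwp : forall i : 'I_n, subproblems_well_posed nu gamma T alpha (d i))
    (htheta0 : 0 < theta) (htheta1 : theta < 1) :
  DN3_converges nu gamma T alpha theta d <->
  rho_DN3 nu gamma T alpha theta d < 1.
Proof.
have step i f f' := DN3_stepE hnu theta f f' halpha0 halphaT (hwp i).
split=> [conv | rho_lt1].
- apply/bigmax_ltP; split=> [|i _]; first exact: ltr01.
  apply: cvg_geometric_lt1.
  (* Starting from 1 in every component, the iterates are the pure powers of the factors. *)
  apply: (conv (fun=> 1)
    (fun k j => DN3_factor nu gamma T alpha theta (d j) ^+ k)).
  split=> [|k j]; first by apply/funext => j; rewrite expr0.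
  by apply/step; rewrite exprS.
- move=> f0 f [f0E iter] i.
  have /bigmax_ltP[_ /(_ i isT) lt1] := rho_lt1.
  have -> : f ^~ i = (fun k => DN3_factor nu gamma T alpha theta (d i) ^+ k * f0 i).
    apply/funext; elim=> [|k IH]; first by rewrite f0E expr0 mul1r.
    by have /step -> := iter k i; rewrite IH exprS mulrA.
  rewrite -(mul0r (f0 i)); apply: cvgMl; exact: cvg_expr.
Qed.
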